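(* Let $K=L\oplus M$ be either an incidence algebra $I(X,R)$ of a locally finite preordered set $X$ over a $T$-algebra $R$, or a formal matrix algebra over $T$ with zero trace ideals. Then the following equalities of $T$-modules hold: 1. $\mathrm{Der}\,K=\mathrm{In}_1(\mathrm{Der}\,K)\oplus\Lambda$; 2. $\mathrm{Ker}\,f=\mathrm{In}_1(\mathrm{Der}\,K)\oplus\Psi$; 3. $\Phi=\mathrm{In}(\mathrm{Der}\,K)+\Psi=\mathrm{In}_1(\mathrm{Der}\,K)\oplus\big(\mathrm{In}_0(\mathrm{Der}\,K)+\Psi\big)$.
   Context: Rings are associative with nonzero identity; $T$ is a commutative ring. Incidence algebra: $(X,\le)$ is a preordered set (reflexive, transitive) all of whose intervals $\{z:x\le z\le y\}$ are finite; $x\sim y$ iff $x\le y$ and $y\le x$. $I(X,R)$ is the $T$-algebra of functions $f:X\times X\to R$ with $f(x,y)=0$ if $x\not\le y$, pointwise addition and $T$-action, product $(fg)(x,y)=\sum_{x\le z\le y}f(x,z)g(z,y)$. Here $L=\{f: f(x,y)=0\text{ if }x\not\sim y\}$ (subalgebra) and $M=\{f: f(x,y)=0\text{ if }x\sim y\}$ (ideal). Formal matrix algebra with zero trace ideals: given $T$-algebras $R_1,\dots,R_n$, $R_i$-$R_j$-bimodules $M_{ij}$ ($i\ne j$; $M_{ii}=R_i$) and bimodule homomorphisms $M_{ij}\otimes_{R_j}M_{jk}\to M_{ik}$ making the set $K$ of matrices $(a_{ij})$, $a_{ij}\in M_{ij}$, an associative $T$-algebra under matrix multiplication; zero trace ideals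 means that the products $M_{ij}M_{ji}$ are zero in $R_i$ for all $i\neq j$. Here $L$ is the subalgebra of diagonal matrices and $M$ is the ideal of matrices with zero diagonal. A derivation of $K$ is a $T$-linear map $d:K\to K$ with $d(ab)=d(a)b+ad(b)$; $\mathrm{Der}\,K$ is the $T$-module of derivations. The inner derivation defined by $c$ is $d_c(a)=ac-ca$; $\mathrm{In}(\mathrm{Der}\,K)$ is the submodule of inner derivations; $\mathrm{In}_0(\mathrm{Der}\,K)$ (resp. $\mathrm{In}_1(\mathrm{Der}\,K)$) is the submodule of inner derivations of $K$ defined by elements of $L$ (resp. $M$). Every derivation $d$ of $K$ satisfies $d(M)\subseteq M$, so $d(a+b)=\alpha(a)+(\delta(a)+\beta(b))$ for $a\in L$, $b\in M$, with $T$-linear $\alpha:L\to L$, $\delta:L\to M$, $\beta:M\to M$, $\alpha\in\mathrm{Der}\,L$. $f:\mathrm{Der}\,K\to\mathrm{Der}\,L$ is $f(d)=\alpha$. $\Lambda$ is the submodule of diagonal derivations ($\delta=0$); $\Psi$ the submodule of derivations with $\alpha=0$ and $\delta=0$; $\Phi=\{d\in\mathrm{Der}\,K:\alpha\in\mathrm{In}(\mathrm{Der}\,L)\}$. *)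

(* Defs.v *)
From HB Require Import structures.
From mathcomp Require Import all_boot all_order all_algebra.
From mathcomp Require Import finmap.
From mathcomp Require Import mathcomp_extra boolp classical_sets functions.
From mathcomp Require Import cardinality fsbigop.

Set Implicit Arguments.
Unset Strict Implicit.
Unset Printing Implicit Defensive.

Import Order.TTheory GRing.Theory.
Local Open Scope classical_set_scope.
Local Open Scope ring_scope.

Section Submodules.
Variables (T : comNzRingType) (V : lmodType T).
Implicit Types A B C : set V.

Definition is_submodule A := submod_closed [pred v | v \in A].

Definition add_set A B : set V := [set a + b | a in A & b in B].

Definition is_direct_sum C A B :=
  [/\ is_submodule A, is_submodule B, C = add_set A B & A `&` B = [set 0]].

End Submodules.

Section Derivations.
Variables (T : comNzRingType) (A : algType T).

Definition Der : set (A -> A) :=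
  [set d | linear d /\ forall a b, d (a * b) = d a * b + a * d b].

Definition inner (c : A) : A -> A := fun a => a * c - c * a.

Definition InDer : set (A -> A) := range inner.

End Derivations.
Arguments Der {T} A.
Arguments InDer {T} A.

Section Subalgebra.
Variables (T : comNzRingType) (K : algType T) (L : subalgClosed K).

(* The subalgebra L of K as an algebra in its own right. *)
Record subalg := Subalg { subalg_val :> K; _ : subalg_val \in L }.
HB.instance Definition _ := [isSub for subalg_val].
HB.instance Definition _ := [Choice of subalg by <:].
HB.instance Definition _ := [SubChoice_isSubAlgebra of subalg by <:].

End Subalgebra.

Section Decomposition.
Variables (T : comNzRingType) (K : algType T) (L : subalgClosed K) (M : set K).

(* The components of x along K = L (+) M. The default value 0 of xget is never
   used for the two kinds of algebras below: see incidence_decomp and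
   formal_matrix_decomp. *)
Definition Lpart (x : K) : subalg L := xget 0 [set a : subalg L | M (x - val a)].
Definition Mpart (x : K) : K := x - val (Lpart x).

(* alpha and delta in d (a + b) = alpha a + (delta a + beta b), a in L, b in M.
   Taking b = 0, they are the two components of d on L. *)
Definition dalpha (d : K -> K) : subalg L -> subalg L :=
  fun a => Lpart (d (val a)).
Definition ddelta (d : K -> K) : subalg L -> K :=
  fun a => Mpart (d (val a)).

Definition In0 : set (K -> K) := [set inner c | c in [set c | c \in L]].
Definition In1 : set (K -> K) := [set inner c | c in M].

(* The kernel of f : Der K -> Der L, d |-> dalpha d. *)
Definition Kerf : set (K -> K) := [set d | Der K d /\ dalpha d = 0].

Definition Lambda : set (K -> K) := [set d | Der K d /\ ddelta d = 0].

Definition Psi : set (K -> K) :=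
  [set d | [/\ Der K d, dalpha d = 0 & ddelta d = 0]].

Definition Phi : set (K -> K) := [set d | Der K d /\ InDer (subalg L) (dalpha d)].

End Decomposition.
Arguments In0 {T K} L.
Arguments In1 {T K} M.

(* Locally finite preordered sets. They are required to be nonempty (pointed)
   because rings, hence incidence algebras, have 1 <> 0. *)
HB.mixin Record isLocallyFinite (disp : Order.disp_t) X
    of Order.Preorder disp X := {
  interval_finite : forall x y : X, finite_set [set z | (x <= z <= y)%O]
}.

#[short(type="locFinPreorderType")]
HB.structure Definition LocFinPreorder (disp : Order.disp_t) :=
  {X of Order.Preorder disp X & isPointed X & isLocallyFinite disp X}.

Definition preorder_sim (disp : Order.disp_t) (X : preorderType disp) (x y : X) :=
  (x <= y)%O && (y <= x)%O.

Section IncidencePred.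
Variables (T : comNzRingType) (disp : Order.disp_t).
Variables (X : locFinPreorderType disp) (R : algType T).

Definition incidence_pred : {pred X -> X -> R} :=
  fun f => `[< forall x y, ~~ (x <= y)%O -> f x y = 0 >].

Lemma incidence_pred_submod : submod_closed incidence_pred.
Proof.
split=> [|a f g /asboolP f0 /asboolP g0]; apply/asboolP => x y xy //.
rewrite -[LHS]/(a *: f x y + g x y).
by rewrite f0 // g0 // scaler0 addr0.
Qed.
HB.instance Definition _ :=
  GRing.isSubmodClosed.Build T _ incidence_pred incidence_pred_submod.

End IncidencePred.
Arguments incidence_pred {T disp} X R.

Section IncidenceAlgebra.
Variables (T : comNzRingType) (disp : Order.disp_t).
Variables (X : locFinPreorderType disp) (R : algType T).

Record incidence : Type := Incidence {
  inc_val :> X -> X -> R;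
  _ : inc_val \in incidence_pred X R
}.
HB.instance Definition _ := [isSub for inc_val].
HB.instance Definition _ := [Choice of incidence by <:].
HB.instance Definition _ := [SubChoice_isSubLmodule of incidence by <:].
Implicit Types f g h : incidence.

Lemma incP f g : (forall x y, f x y = g x y) -> f = g.
Proof.
by move=> fg; apply: val_inj; apply/funext => x; apply/funext => y; apply: fg.
Qed.

Lemma inc0 f x y : ~~ (x <= y)%O -> f x y = 0.
Proof. by case: f => f /= /asboolP; apply. Qed.

Lemma incD f g x y : (f + g) x y = f x y + g x y. Proof. by []. Qed.
Lemma incN f x y : (- f) x y = - f x y. Proof. by []. Qed.
Lemma incZ t f x y : (t *: f) x y = t *: f x y. Proof. by []. Qed.

Definition inc_mul_fun f g : X -> X -> R :=
  fun x y => \sum_(z \in [set z | (x <= z <= y)%O]) f x z * g z y.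

Definition inc_one_fun : X -> X -> R := fun x y => (x == y)%:R.

Lemma inc_mul_subproof f g : inc_mul_fun f g \in incidence_pred X R.
Proof.
apply/asboolP => x y xy; rewrite /inc_mul_fun fsbig1// => z /= /andP[xz zy].
by rewrite (le_trans xz zy) in xy.
Qed.

Lemma inc_one_subproof : inc_one_fun \in incidence_pred X R.
Proof.
apply/asboolP => x y; rewrite /inc_one_fun.
by case: eqP => // ->; rewrite lexx.
Qed.

Definition inc_mul f g := Incidence (inc_mul_subproof f g).
Definition inc_one := Incidence inc_one_subproof.

Lemma inc_mulE (s : seq X) f g x y : uniq s ->
    (forall z, (x <= z <= y)%O -> z \in s) ->
  inc_mul f g x y = \sum_(z <- s) f x z * g z y.
Proof.
move=> s_uniq ss; rewrite -[LHS]/(inc_mul_fun f g x y) /inc_mul_fun.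
rewrite (fsbig_finite _ _ (interval_finite x y)) /=.
rewrite [RHS](bigID (fun z => (x <= z <= y)%O)) /= [X in _ + X]big1 ?addr0.
  rewrite -[RHS]big_filter; apply: perm_big; apply: uniq_perm.
  - exact: fset_uniq.
  - exact: filter_uniq.
  move=> z; rewrite mem_filter in_fset_set; last exact: interval_finite.
  apply/idP/andP => [|[xzy _]]; last by rewrite inE.
  by rewrite inE /= => xzy; split=> //; apply: ss.
move=> z; rewrite negb_and => /orP[xz|zy]; first by rewrite inc0 // mul0r.
by rewrite [g _ _]inc0 // mulr0.
Qed.

Definition itvs (x y : X) : seq X := fset_set [set z | (x <= z <= y)%O].

Lemma itvs_uniq x y : uniq (itvs x y). Proof. exact: fset_uniq. Qed.

Lemma mem_itvs x y z : (z \in itvs x y) = (x <= z <= y)%O.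
Proof.
rewrite /itvs in_fset_set; last exact: interval_finite.
by apply/idP/idP; rewrite inE.
Qed.

Lemma inc_mul_itvE f g x y :
  inc_mul f g x y = \sum_(z <- itvs x y) f x z * g z y.
Proof. by apply: inc_mulE (itvs_uniq x y) _ => z; rewrite mem_itvs. Qed.

Lemma inc_mulA : associative inc_mul.
Proof.
move=> f g h; apply: incP => x y; rewrite !inc_mul_itvE.
under eq_big_seq => z; first rewrite mem_itvs => /andP[xz zy].
  rewrite (@inc_mulE (itvs x y)) ?itvs_uniq //; last first.
    by move=> w /andP[zw wy]; rewrite mem_itvs wy (le_trans xz zw).
  rewrite big_distrr /=; over.
under [RHS]eq_big_seq => w; first rewrite mem_itvs => /andP[xw wy].
  rewrite (@inc_mulE (itvs x y)) ?itvs_uniq //; last first.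
    by move=> z /andP[xz zw]; rewrite mem_itvs xz (le_trans zw wy).
  rewrite big_distrl /=; over.
by rewrite exchange_big /=; do 2!apply: eq_bigr => ? _; rewrite mulrA.
Qed.

Lemma inc_mul1 : left_id inc_one inc_mul.
Proof.
move=> f; apply: incP => x y; have [xy|xy] := boolP (x <= y)%O; last first.
  by rewrite !inc0.
rewrite inc_mul_itvE (bigD1_seq x) ?itvs_uniq ?mem_itvs ?lexx //=.
rewrite /inc_one_fun eqxx mul1r big1 ?addr0 // => z zx.
by rewrite eq_sym (negPf zx) mul0r.
Qed.

Lemma inc_mulr1 : right_id inc_one inc_mul.
Proof.
move=> f; apply: incP => x y; have [xy|xy] := boolP (x <= y)%O; last first.
  by rewrite !inc0.
rewrite inc_mul_itvE (bigD1_seq y) ?itvs_uniq ?mem_itvs ?lexx ?andbT //=.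
rewrite /inc_one_fun eqxx mulr1 big1 ?addr0 // => z zy.
by rewrite (negPf zy) mulr0.
Qed.

Lemma inc_mulDl : left_distributive inc_mul +%R.
Proof.
move=> f g h; apply: incP => x y; rewrite incD !inc_mul_itvE -big_split /=.
by apply: eq_bigr => z _; rewrite mulrDl.
Qed.

Lemma inc_mulDr : right_distributive inc_mul +%R.
Proof.
move=> f g h; apply: incP => x y; rewrite incD !inc_mul_itvE -big_split /=.
by apply: eq_bigr => z _; rewrite mulrDr.
Qed.

Lemma inc_one_neq0 : inc_one != 0.
Proof.
apply/eqP => /(congr1 (fun f : incidence => f point point)) /eqP.
by rewrite /= /inc_one_fun eqxx oner_eq0.
Qed.

HB.instance Definition _ := GRing.Zmodule_isNzRing.Build incidence
  inc_mulA inc_mul1 inc_mulr1 inc_mulDl inc_mulDr inc_one_neq0.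

Lemma inc_scalerAl t f g : t *: (f * g) = (t *: f) * g.
Proof.
apply: incP => x y; rewrite incZ !inc_mul_itvE scaler_sumr.
by apply: eq_bigr => z _; rewrite scalerAl.
Qed.

HB.instance Definition _ :=
  GRing.Lmodule_isLalgebra.Build T incidence inc_scalerAl.

Lemma inc_scalerAr t f g : t *: (f * g) = f * (t *: g).
Proof.
apply: incP => x y; rewrite incZ !inc_mul_itvE scaler_sumr.
by apply: eq_bigr => z _; rewrite scalerAr.
Qed.

HB.instance Definition _ :=
  GRing.Lalgebra_isAlgebra.Build T incidence inc_scalerAr.

Definition incidence_L : {pred incidence} :=
  fun f => `[< forall x y, ~~ preorder_sim x y -> f x y = 0 >].

Definition incidence_M : set incidence :=
  [set f : incidence | forall x y, preorder_sim x y -> f x y = 0].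

Lemma incidence_L_subalg : subalg_closed incidence_L.
Proof.
split=> [|t f g /asboolP f0 /asboolP g0|f g /asboolP f0 /asboolP g0];
  apply/asboolP => x y xy.
- rewrite /= /inc_one_fun; case: eqP xy => // ->.
  by rewrite /preorder_sim lexx.
- by rewrite incD incZ f0 // g0 // scaler0 addr0.
- rewrite inc_mul_itvE big_seq big1 // => z; rewrite mem_itvs => /andP[xz zy].
  have [xz'|xz'] := boolP (preorder_sim x z); last by rewrite f0 // mul0r.
  rewrite [g _ _]g0 ?mulr0 //; apply: contra xy => /andP[_ yz].
  move: xz' => /andP[_ zx].
  by rewrite /preorder_sim (le_trans xz zy) (le_trans yz zx).
Qed.
HB.instance Definition _ :=
  GRing.isSubalgClosed.Build T incidence incidence_L incidence_L_subalg.

Lemma incidence_decomp f :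
  exists! a : subalg incidence_L, incidence_M (f - val a).
Proof.
pose a x y := if preorder_sim x y then f x y else 0.
have aP : a \in incidence_pred X R.
  by apply/asboolP => x y xy; rewrite /a inc0 // if_same.
have aL : Incidence aP \in incidence_L.
  by apply/asboolP => x y /negPf xy; rewrite /= /a xy.
exists (Subalg aL); split=> [x y xy|b bM].
  by rewrite incD incN /= /a xy subrr.
apply: val_inj; apply: incP => x y /=; rewrite /a.
case: ifP => [xy|/negbT xy].
  by apply/eqP; rewrite -subr_eq0; apply/eqP; exact: bM.
by case: b {bM} => b /= /asboolP ->.
Qed.

End IncidenceAlgebra.
Arguments incidence_L {T disp} X R.
Arguments incidence_M {T disp} X R.

(* A-B-bimodules over the T-algebras A and B, on which T acts the same way
   through A and through B. *)
Record bimodule (T : comNzRingType) (A B : algType T) := Bimodule {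
  bim_sort :> lmodType T;
  lact : A -> bim_sort -> bim_sort;
  ract : bim_sort -> B -> bim_sort;
  lact_linearl : forall x, linear (lact^~ x);
  lact_linearr : forall a, linear (lact a);
  ract_linearl : forall b, linear (ract^~ b);
  ract_linearr : forall x, linear (ract x);
  lact1 : forall x, lact 1 x = x;
  ract1 : forall x, ract x 1 = x;
  lactA : forall a a' x, lact (a * a') x = lact a (lact a' x);
  ractA : forall x b b', ract x (b * b') = ract (ract x b) b';
  lractA : forall a x b, ract (lact a x) b = lact a (ract x b)
}.

(* Data of a formal matrix algebra of size n.+1. The equality M_ii = R_i is
   rendered by an isomorphism fm_diag of R_i-R_i-bimodules, along which the
   products M_ii x M_ij -> M_ij and M_ij x M_jj -> M_ij are the bimodule
   actions. The homomorphisms M_ij (x)_(R_j) M_jk -> M_ik are given as the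
   corresponding balanced T-bilinear maps fm_mul. *)
Record formal_matrix_data (T : comNzRingType) (n : nat) := FormalMatrixData {
  fm_ring : 'I_n.+1 -> algType T;
  fm_bim : forall i j, bimodule (fm_ring i) (fm_ring j);
  fm_diag : forall i, fm_ring i -> fm_bim i i;
  fm_mul : forall i j k, fm_bim i j -> fm_bim j k -> fm_bim i k;
  fm_diag_linear : forall i, linear (@fm_diag i);
  fm_diag_bij : forall i, bijective (@fm_diag i);
  fm_diag_lact : forall i (a b : fm_ring i),
    fm_diag (a * b) = lact a (fm_diag b);
  fm_diag_ract : forall i (a b : fm_ring i),
    fm_diag (a * b) = ract (fm_diag a) b;
  fm_mul_linearl : forall i j k (y : fm_bim j k),
    linear (fun x : fm_bim i j => fm_mul x y);
  fm_mul_linearr : forall i j k (x : fm_bim i j),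
    linear (fun y : fm_bim j k => fm_mul x y);
  fm_mul_lact : forall i j k (a : fm_ring i) (x : fm_bim i j) (y : fm_bim j k),
    fm_mul (lact a x) y = lact a (fm_mul x y);
  fm_mul_ract : forall i j k (x : fm_bim i j) (y : fm_bim j k) (c : fm_ring k),
    fm_mul x (ract y c) = ract (fm_mul x y) c;
  fm_mul_balanced : forall i j k (x : fm_bim i j) (b : fm_ring j)
      (y : fm_bim j k),
    fm_mul (ract x b) y = fm_mul x (lact b y);
  fm_mul_diagl : forall i j (a : fm_ring i) (x : fm_bim i j),
    fm_mul (fm_diag a) x = lact a x;
  fm_mul_diagr : forall i j (x : fm_bim i j) (b : fm_ring j),
    fm_mul x (fm_diag b) = ract x b;
  fm_mulA : forall i j k l (x : fm_bim i j) (y : fm_bim j k) (z : fm_bim k l),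
    fm_mul x (fm_mul y z) = fm_mul (fm_mul x y) z
}.

Arguments fm_diag {T n} f {i} _.
Arguments fm_diag_bij {T n} f i.

Section FormalMatrixAlgebra.
Variables (T : comNzRingType) (n : nat) (D : formal_matrix_data T n).
Local Notation I := 'I_n.+1.

(* The ideal M_ij M_ji of R_i is generated as a group by the products x y. *)
Definition zero_trace_ideals := forall (i j : I), i != j ->
  forall (x : fm_bim D i j) (y : fm_bim D j i), fm_mul x y = 0.

Definition formal_matrix : Type := forall i j : I, fm_bim D i j.

HB.instance Definition _ := gen_eqMixin formal_matrix.
HB.instance Definition _ := gen_choiceMixin formal_matrix.
Implicit Types a b c : formal_matrix.

Lemma fmP a b : (forall i j, a i j = b i j) -> a = b.
Proof.
move=> ab; apply: functional_extensionality_dep => i.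
by apply: functional_extensionality_dep => j; apply: ab.
Qed.

Definition fm_zero : formal_matrix := fun i j => 0.
Definition fm_opp a : formal_matrix := fun i j => - a i j.
Definition fm_add a b : formal_matrix := fun i j => a i j + b i j.
Definition fm_scale t a : formal_matrix := fun i j => t *: a i j.

Lemma fm_addA : associative fm_add.
Proof. by move=> a b c; apply: fmP => i j; apply: addrA. Qed.
Lemma fm_addC : commutative fm_add.
Proof. by move=> a b; apply: fmP => i j; apply: addrC. Qed.
Lemma fm_add0 : left_id fm_zero fm_add.
Proof. by move=> a; apply: fmP => i j; apply: add0r. Qed.
Lemma fm_addN : left_inverse fm_zero fm_opp fm_add.
Proof. by move=> a; apply: fmP => i j; apply: addNr. Qed.
HB.instance Definition _ := GRing.isZmodule.Build formal_matrix
  fm_addA fm_addC fm_add0 fm_addN.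

Lemma fm_scaleA s t a : fm_scale s (fm_scale t a) = fm_scale (s * t) a.
Proof. by apply: fmP => i j; apply: scalerA. Qed.
Lemma fm_scale1 : left_id 1 fm_scale.
Proof. by move=> a; apply: fmP => i j; apply: scale1r. Qed.
Lemma fm_scaleDr : right_distributive fm_scale +%R.
Proof. by move=> t a b; apply: fmP => i j; apply: scalerDr. Qed.
Lemma fm_scaleDl a : {morph fm_scale^~ a : s t / s + t}.
Proof. by move=> s t; apply: fmP => i j; apply: scalerDl. Qed.
HB.instance Definition _ := GRing.Zmodule_isLmodule.Build T formal_matrix
  fm_scaleA fm_scale1 fm_scaleDr fm_scaleDl.

Lemma fmDE a b i j : (a + b) i j = a i j + b i j. Proof. by []. Qed.
Lemma fmNE a i j : (- a) i j = - a i j. Proof. by []. Qed.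
Lemma fmZE t a i j : (t *: a) i j = t *: a i j. Proof. by []. Qed.

Definition fm_prod a b : formal_matrix :=
  fun i k => \sum_(j < n.+1) fm_mul (a i j) (b j k).

(* 1_i in M_ii on the diagonal, 0 elsewhere; the match transports 1_i along
   i = j. *)
Definition fm_one : formal_matrix := fun i j =>
  match i =P j with
  | ReflectT e => ecast j (fm_bim D i j) e (fm_diag D (1 : fm_ring D i))
  | ReflectF _ => 0
  end.

Lemma fm_mulDl i j k (x x' : fm_bim D i j) (y : fm_bim D j k) :
  fm_mul (x + x') y = fm_mul x y + fm_mul x' y.
Proof. by have := fm_mul_linearl y 1 x x'; rewrite /= !scale1r. Qed.
Lemma fm_mulDr i j k (x : fm_bim D i j) (y y' : fm_bim D j k) :
  fm_mul x (y + y') = fm_mul x y + fm_mul x y'.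
Proof. by have := fm_mul_linearr x 1 y y'; rewrite /= !scale1r. Qed.
Lemma fm_mul0l i j k (y : fm_bim D j k) : fm_mul (0 : fm_bim D i j) y = 0.
Proof. by apply: (addrI (fm_mul 0 y)); rewrite -fm_mulDl !addr0. Qed.
Lemma fm_mul0r i j k (x : fm_bim D i j) : fm_mul x (0 : fm_bim D j k) = 0.
Proof. by apply: (addrI (fm_mul x 0)); rewrite -fm_mulDr !addr0. Qed.
Lemma fm_mulZl i j k t (x : fm_bim D i j) (y : fm_bim D j k) :
  fm_mul (t *: x) y = t *: fm_mul x y.
Proof. by have := fm_mul_linearl y t x 0; rewrite /= fm_mul0l !addr0. Qed.
Lemma fm_mulZr i j k t (x : fm_bim D i j) (y : fm_bim D j k) :
  fm_mul x (t *: y) = t *: fm_mul x y.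
Proof. by have := fm_mul_linearr x t y 0; rewrite /= fm_mul0r !addr0. Qed.

Lemma fm_mul_suml i j k (J : Type) (s : seq J) (F : J -> fm_bim D i j)
    (y : fm_bim D j k) :
  fm_mul (\sum_(u <- s) F u) y = \sum_(u <- s) fm_mul (F u) y.
Proof.
elim: s => [|u s IHs]; first by rewrite !big_nil fm_mul0l.
by rewrite !big_cons fm_mulDl IHs.
Qed.
Lemma fm_mul_sumr i j k (J : Type) (s : seq J) (F : J -> fm_bim D j k)
    (x : fm_bim D i j) :
  fm_mul x (\sum_(u <- s) F u) = \sum_(u <- s) fm_mul x (F u).
Proof.
elim: s => [|u s IHs]; first by rewrite !big_nil fm_mul0r.
by rewrite !big_cons fm_mulDr IHs.
Qed.

Lemma fm_prodA : associative fm_prod.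
Proof.
move=> a b c; apply: fmP => i l; rewrite /fm_prod.
under eq_bigr do rewrite fm_mul_sumr.
under [RHS]eq_bigr do rewrite fm_mul_suml.
rewrite exchange_big /=; apply: eq_bigr => k _; apply: eq_bigr => j _.
exact: fm_mulA.
Qed.

Lemma fm_one_diag i : fm_one i i = fm_diag D (1 : fm_ring D i).
Proof.
by rewrite /fm_one; case: eqP => // e; rewrite (eq_irrelevance e erefl).
Qed.
Lemma fm_one_off i j : i != j -> fm_one i j = 0.
Proof. by rewrite /fm_one; case: eqP. Qed.

Lemma fm_prod1 : left_id fm_one fm_prod.
Proof.
move=> a; apply: fmP => i k; rewrite /fm_prod (bigD1 i) //= fm_one_diag.
rewrite fm_mul_diagl lact1 big1 ?addr0 // => j ji.
by rewrite fm_one_off ?fm_mul0l // eq_sym.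
Qed.
Lemma fm_prodr1 : right_id fm_one fm_prod.
Proof.
move=> a; apply: fmP => i k; rewrite /fm_prod (bigD1 k) //= fm_one_diag.
rewrite fm_mul_diagr ract1 big1 ?addr0 // => j jk.
by rewrite fm_one_off ?fm_mul0r.
Qed.
Lemma fm_prodDl : left_distributive fm_prod +%R.
Proof.
move=> a b c; apply: fmP => i k; rewrite fmDE /fm_prod -big_split /=.
by apply: eq_bigr => j _; rewrite fmDE fm_mulDl.
Qed.
Lemma fm_prodDr : right_distributive fm_prod +%R.
Proof.
move=> a b c; apply: fmP => i k; rewrite fmDE /fm_prod -big_split /=.
by apply: eq_bigr => j _; rewrite fmDE fm_mulDr.
Qed.
Lemma fm_one_neq0 : fm_one != 0.
Proof.
apply/eqP => /(congr1 (fun a : formal_matrix => a ord0 ord0)).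
rewrite fm_one_diag => d1.
have d0 : fm_diag D (0 : fm_ring D ord0) = 0.
  have := fm_diag_lact (0 : fm_ring D ord0) 1.
  by rewrite mulr1 d1 -fm_mul_diagl fm_mul0r.
have := bij_inj (fm_diag_bij D ord0) (etrans d1 (esym d0)).
by move/eqP; rewrite oner_eq0.
Qed.
HB.instance Definition _ := GRing.Zmodule_isNzRing.Build formal_matrix
  fm_prodA fm_prod1 fm_prodr1 fm_prodDl fm_prodDr fm_one_neq0.

Lemma fm_scalerAl t a b : t *: (a * b) = (t *: a) * b.
Proof.
apply: fmP => i k; rewrite fmZE /GRing.mul /= /fm_prod scaler_sumr.
by apply: eq_bigr => j _; rewrite fmZE fm_mulZl.
Qed.
HB.instance Definition _ :=
  GRing.Lmodule_isLalgebra.Build T formal_matrix fm_scalerAl.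

Lemma fm_scalerAr t a b : t *: (a * b) = a * (t *: b).
Proof.
apply: fmP => i k; rewrite fmZE /GRing.mul /= /fm_prod scaler_sumr.
by apply: eq_bigr => j _; rewrite fmZE fm_mulZr.
Qed.
HB.instance Definition _ :=
  GRing.Lalgebra_isAlgebra.Build T formal_matrix fm_scalerAr.

Definition formal_matrix_L : {pred formal_matrix} :=
  fun a => `[< forall i j, i != j -> a i j = 0 >].

Definition formal_matrix_M : set formal_matrix :=
  [set a : formal_matrix | forall i, a i i = 0].

Lemma formal_matrix_L_subalg : subalg_closed formal_matrix_L.
Proof.
split=> [|t a b /asboolP a0 /asboolP b0|a b /asboolP a0 /asboolP b0];
  apply/asboolP => i j ij.
- exact: fm_one_off.
- by rewrite fmDE fmZE a0 // b0 // scaler0 addr0.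
- rewrite /GRing.mul /= /fm_prod big1 // => k _.
  have [ik|ik] := eqVneq i k; last by rewrite a0 // fm_mul0l.
  by rewrite b0 ?fm_mul0r // -ik.
Qed.
HB.instance Definition _ := GRing.isSubalgClosed.Build T formal_matrix
  formal_matrix_L formal_matrix_L_subalg.

Lemma formal_matrix_decomp a :
  exists! l : subalg formal_matrix_L, formal_matrix_M (a - val l).
Proof.
pose l : formal_matrix := fun i j => if i == j then a i j else 0.
have lL : l \in formal_matrix_L.
  by apply/asboolP => i j /negPf ij; rewrite /l ij.
exists (Subalg lL); split=> [i|m mM].
  by rewrite fmDE fmNE /= /l eqxx subrr.
apply: val_inj; apply: fmP => i j /=; rewrite /l.
case: eqVneq => [<-|ij].
  by apply/eqP; rewrite -subr_eq0; apply/eqP; exact: mM.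
by case: m {mM} => m /= /asboolP ->.
Qed.

End FormalMatrixAlgebra.
Arguments formal_matrix_L {T n} D.
Arguments formal_matrix_M {T n} D.

Inductive incidence_or_formal_matrix (T : comNzRingType) :
    forall K : algType T, subalgClosed K -> set K -> Prop :=
| IncidenceCase (disp : Order.disp_t) (X : locFinPreorderType disp)
    (R : algType T) :
    @incidence_or_formal_matrix T (incidence X R)
      (incidence_L X R) (incidence_M X R)
| FormalMatrixCase (n : nat) (D : formal_matrix_data T n) :
    zero_trace_ideals D ->
    @incidence_or_formal_matrix T (formal_matrix D)
      (formal_matrix_L D) (formal_matrix_M D).

(* Main.v *)
(** Both kinds of algebras carry a set [E] of idempotents of [L] (the units of
    the diagonal blocks) that commute with [L] and satisfy [M = {x | e x e = 0}].
    If [d] is a derivation with component [delta : L -> M], applying [delta] to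
    [a e = e a] and multiplying by [e] on the left gives, for [a] in [L],
    [e delta(a) = a (e delta(e)) - (e delta(e)) a].  Gluing the blocks
    [e delta(e)] into one element [c] of [M] shows that [delta] is [inner c]
    restricted to [L], so that [d - inner c] is diagonal.  Conversely, an element
    [c] of [M] commuting with [L] is zero, as [e c = e c e = 0].  The
    modular law then splits [In1] off every submodule of [Der K] containing it. *)
Require Import Defs.
From mathcomp Require Import all_boot all_order all_algebra.
From mathcomp Require Import boolp classical_sets functions.

Set Implicit Arguments.
Unset Strict Implicit.
Unset Printing Implicit Defensive.

Import Order.TTheory GRing.Theory.
Local Open Scope classical_set_scope.
Local Open Scope ring_scope.

(** * Submodules as propositional subsets *)

Section SubmoduleTheory.
Variables (T : comNzRingType) (V : lmodType T).
Implicit Types A B C : set V.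

(** Replaces boolean membership by application of the set, so that witnesses of images and
    conjunctions can be destructed directly. *)
Lemma is_submoduleP A :
  is_submodule A <-> A 0 /\ forall t u v, A u -> A v -> A (t *: u + v).
Proof.
split=> -[A0 AD]; split=> [|t u v]; first by move: A0; rewrite !inE.
- by move=> Au Av; have := AD t u v; rewrite !inE; apply.
- by rewrite !inE.
- by rewrite !inE; apply: AD.
Qed.

Lemma submoduleD A u v : is_submodule A -> A u -> A v -> A (u + v).
Proof. by move=> /is_submoduleP[_ AD] Au Av; rewrite -[u]scale1r; apply: AD. Qed.

Lemma submoduleB A u v : is_submodule A -> A u -> A v -> A (u - v).
Proof.
by move=> /is_submoduleP[_ AD] Au Av; rewrite addrC -scaleN1r; apply: AD.
Qed.

Lemma submoduleI A B :
  is_submodule A -> is_submodule B -> is_submodule (A `&` B).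
Proof.
move=> /is_submoduleP[A0 AD] /is_submoduleP[B0 BD]; apply/is_submoduleP.
by split=> // t u v [Au Bu] [Av Bv]; split; [apply: AD | apply: BD].
Qed.

End SubmoduleTheory.

(** * Derivations and inner derivations of an arbitrary algebra *)

Section DerivationTheory.
Variables (T : comNzRingType) (A : algType T).
Implicit Types (c : A) (d : A -> A).

Lemma Der_submodule : is_submodule (Der A).
Proof.
apply/is_submoduleP; split=> [|t d d' [dl dM] [dl' dM']]; split.
- by move=> s x y; rewrite /= scaler0 addr0.
- by move=> x y; rewrite /= mul0r mulr0 addr0.
- move=> s x y; rewrite -[LHS]/(t *: d _ + d' _).
  rewrite -[RHS]/(_ *: (_ *: _ + _) + (_ *: _ + _)).
  by rewrite dl dl' !scalerDr !scalerA [s * t]mulrC addrACA.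
- move=> x y; rewrite -[LHS]/(t *: d _ + d' _).
  rewrite -[RHS]/((_ *: _ + _) * _ + _ * (_ *: _ + _)).
  by rewrite dM dM' mulrDl mulrDr -scalerAl -scalerAr scalerDr addrACA.
Qed.

Lemma inner_der c : Der A (inner c).
Proof.
split=> [t x y|x y]; rewrite /inner.
  by rewrite mulrDl mulrDr -scalerAl -scalerAr opprD addrACA -scalerBr.
by rewrite mulrBl mulrBr !mulrA [RHS]addrC addrA addrNK.
Qed.

Lemma inner_linear : linear (@inner T A).
Proof.
move=> t c c'; apply/funext => x.
rewrite -[RHS]/(t *: (x * c - c * x) + (x * c' - c' * x)) /inner.
by rewrite mulrDl mulrDr -scalerAl -scalerAr opprD addrACA -scalerBr.
Qed.

Lemma image_inner_submodule (C : set A) :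
  is_submodule C -> is_submodule [set inner c | c in C].
Proof.
move=> /is_submoduleP[C0 CD]; apply/is_submoduleP; split.
  by exists 0 => //; apply/funext => x; rewrite /inner mulr0 mul0r subrr.
move=> t _ _ [c Cc <-] [c' Cc' <-].
by exists (t *: c + c'); [apply: CD | rewrite inner_linear].
Qed.

End DerivationTheory.

(** * Algebras [K = L + M] with a set of block idempotents *)

Section BlockDecomposition.
Variables (T : comNzRingType) (K : algType T) (L : subalgClosed K) (M : set K).

(** [E] may be infinite, so its elements cannot simply be summed to 1. The last two fields stand in
    for that sum: an element is determined by its block rows [e x], and block rows taken from
    elements [g e] of [M] assemble into one element of [M]. *)
Record block_idempotents (E : set K) : Prop := BlockIdempotents {
  block_decomp : forall x, exists! a : subalg L, M (x - val a);
  block_sub : forall e, E e -> e \in L;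
  block_idem : forall e, E e -> e * e = e;
  block_comm : forall e a, E e -> a \in L -> e * a = a * e;
  block_off : forall x, M x <-> forall e, E e -> e * x * e = 0;
  block_faithful : forall x, (forall e, E e -> e * x = 0) -> x = 0;
  block_glue : forall g : K -> K, (forall e, E e -> M (g e)) ->
    exists2 c, M c & forall e, E e -> e * c = e * g e
}.

Variables (E : set K) (BE : block_idempotents E).
Implicit Types (a b : subalg L) (d : K -> K).
Local Notation dalpha := (@dalpha T K L M).
Local Notation ddelta := (@ddelta T K L M).

Lemma subalgP a : val a \in L. Proof. exact: valP. Qed.

Lemma val_linear : linear (val : subalg L -> K).
Proof. by []. Qed.

Lemma M_submodule : is_submodule M.
Proof.
apply/is_submoduleP; split=> [|t x y].
  by apply/(block_off BE) => e _; rewrite mulr0 mul0r.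
move=> /(block_off BE) Mx /(block_off BE) My; apply/(block_off BE) => e Ee.
by rewrite mulrDr mulrDl -scalerAr -scalerAl Mx// My// scaler0 addr0.
Qed.

(** As [e] commutes with [a], one has [e a x e = a (e x e) = 0]. *)
Lemma mulLM a x : M x -> M (val a * x).
Proof.
move=> /(block_off BE) Mx; apply/(block_off BE) => e Ee.
by rewrite mulrA (block_comm BE Ee (subalgP a)) -!mulrA [e * _]mulrA Mx// mulr0.
Qed.

Lemma mulML a x : M x -> M (x * val a).
Proof.
move=> /(block_off BE) Mx; apply/(block_off BE) => e Ee.
by rewrite -!mulrA -(block_comm BE Ee (subalgP a)) !mulrA Mx// mul0r.
Qed.

Lemma LpartP x : M (x - val (Lpart L M x)).
Proof.
rewrite /Lpart; have [a [Ma _]] := block_decomp BE x.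
(* The component [a] exists, so the default branch of [xget] is contradictory. *)
by case: xgetP => [_ _ //|/(_ a)[]].
Qed.

Lemma Lpart_unique x a : M (x - val a) -> Lpart L M x = a.
Proof.
move=> Ma; have [b [_ bP]] := block_decomp BE x.
by rewrite -(bP _ (LpartP x)) -(bP _ Ma).
Qed.

Lemma Lpart_val a : Lpart L M (val a) = a.
Proof.
apply: Lpart_unique; rewrite subrr.
by case/is_submoduleP: M_submodule.
Qed.

Lemma Lpart_M x : M x -> Lpart L M x = 0.
Proof. by move=> Mx; apply: Lpart_unique; rewrite (raddf0 val) ?subr0. Qed.

(** By uniqueness of components, it is enough that [M] is closed under linear combinations. *)
Lemma Lpart_linear : linear (Lpart L M).
Proof.
move=> t x y; apply: Lpart_unique.
rewrite val_linear opprD addrACA -scalerBr.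
case/is_submoduleP: M_submodule => _; apply; exact: LpartP.
Qed.

Lemma Mpart_linear : linear (Mpart L M).
Proof.
move=> t x y; rewrite /Mpart Lpart_linear.
by rewrite val_linear opprD addrACA -scalerBr.
Qed.

Lemma Mpart_M x : M x -> Mpart L M x = x.
Proof. by move=> Mx; rewrite /Mpart Lpart_M// (raddf0 val) subr0. Qed.

Lemma Mpart_val a : Mpart L M (val a) = 0.
Proof. by rewrite /Mpart Lpart_val subrr. Qed.

(** Since [L M] lies in [M], uniqueness identifies the [L]-component of [a x] with [a] times that of
    [x]. With the right-hand version, the projection to [M] is a map of [L]-bimodules. *)
Lemma Mpart_mull a x : Mpart L M (val a * x) = val a * Mpart L M x.
Proof.
rewrite [LHS]/Mpart (@Lpart_unique _ (a * Lpart L M x)) (rmorphM val) /= -mulrBr//.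
exact/mulLM/LpartP.
Qed.

Lemma Mpart_mulr x a : Mpart L M (x * val a) = Mpart L M x * val a.
Proof.
rewrite [LHS]/Mpart (@Lpart_unique _ (Lpart L M x * a)) (rmorphM val) /= -mulrBl//.
exact/mulML/LpartP.
Qed.

Lemma dalpha_linear : linear (dalpha).
Proof. by move=> t d d'; apply/funext => a; apply: Lpart_linear. Qed.

Lemma ddelta_linear : linear (ddelta).
Proof. by move=> t d d'; apply/funext => a; apply: Mpart_linear. Qed.

Lemma inner_M c a : M c -> M (inner c (val a)).
Proof.
by move=> Mc; apply: submoduleB M_submodule _ _; [apply: mulLM | apply: mulML].
Qed.

Lemma dalpha_inner_M c : M c -> dalpha (inner c) = 0.
Proof. by move=> Mc; apply/funext => a; apply/Lpart_M/inner_M. Qed.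

Lemma ddelta_inner_M c a : M c -> ddelta (inner c) a = inner c (val a).
Proof. by move=> Mc; apply/Mpart_M/inner_M. Qed.

Lemma inner_val b a : inner (val b) (val a) = val (inner b a).
Proof. by []. Qed.

Lemma dalpha_inner_val b : dalpha (inner (val b)) = inner b.
Proof. by apply/funext => a; rewrite /dalpha inner_val Lpart_val. Qed.

Lemma ddelta_inner_val b : ddelta (inner (val b)) = 0.
Proof. by apply/funext => a; rewrite /ddelta inner_val Mpart_val. Qed.

(** Thus [delta] is a derivation of [L] with values in the bimodule [M]: the Leibniz rule of [d] is
    projected to [M]. *)
Lemma ddelta_mul d a b : Der K d ->
  ddelta d (a * b) = ddelta d a * val b + val a * ddelta d b.
Proof.
case=> _ dM; rewrite /ddelta (rmorphM val) dM -[X in X + _]scale1r Mpart_linear.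
by rewrite scale1r Mpart_mulr Mpart_mull.
Qed.

Lemma ddelta_inner d : Der K d ->
  exists2 c, M c & ddelta d = ddelta (inner c).
Proof.
move=> dD.
have MM x : M (Mpart L M x) by apply: LpartP.
(* On [E] this [g] is [delta], so [e c = e delta(e)] for every [e] in [E]. *)
have [c Mc cE] := block_glue BE (g := Mpart L M \o d) (fun e _ => MM _).
exists c => //; apply/funext => a; rewrite ddelta_inner_M//.
apply/eqP; rewrite -subr_eq0; apply/eqP/(block_faithful BE) => e Ee.
have eL := block_sub BE Ee; pose e' := Subalg eL.
have aL := subalgP a.
have ea : e' * a = a * e' by apply: val_inj; apply: (block_comm BE Ee aL).
(* With [u = delta(e)] and [v = delta(a)], this gives [u a + e v = v e + a u]; left multiplication
   by [e] removes [v e], because [e v e = 0]. *)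
have /(congr1 (ddelta d)) := ea; rewrite !ddelta_mul //=.
have eve := (block_off BE _).1 (MM (d (val a))) e Ee.
have := cE e Ee; rewrite /= -[Mpart _ _ _]/(ddelta d e').
move: eve; rewrite -[Mpart _ _ _]/(ddelta d a).
move: (ddelta d a) (ddelta d e') => v u eve ec /(congr1 ( *%R e)).
rewrite mulrDr [RHS]mulrDr mulrA [e * (e * v)]mulrA (block_idem BE Ee).
rewrite [e * (v * e)]mulrA eve add0r mulrA (block_comm BE Ee aL) -[RHS]mulrA.
(* [H] reads [e c a + e v = a (e c)], which is [e v = e (a c - c a)] rearranged. *)
rewrite -ec => H; rewrite /inner opprB [v + _]addrCA mulrDr mulrBr.
rewrite [e * (c * _)]mulrA [e * (_ * c)]mulrA (block_comm BE Ee aL).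
by rewrite -[_ * e * c]mulrA addrA H subrr.
Qed.

(** Gives the trivial intersections: evaluated at [e], the hypothesis says that [c] commutes with
    [e]. *)
Lemma inner_M_diagonal c : M c -> ddelta (inner c) = 0 -> c = 0.
Proof.
move=> Mc c0; apply: (block_faithful BE) => e Ee.
have := congr1 (@^~ (Subalg (block_sub BE Ee))) c0.
rewrite ddelta_inner_M// => /subr0_eq /= ec.
rewrite -(block_idem BE Ee) -mulrA ec mulrA.
exact: (block_off BE c).1.
Qed.

Lemma ddelta0_submodule : is_submodule [set d | ddelta d = 0].
Proof.
apply/is_submoduleP; split=> [|t d d' /= d0 d'0]; last first.
  by rewrite ddelta_linear d0 d'0 scaler0 addr0.
by apply/funext => a; apply: (Mpart_val 0).
Qed.

(** Common source of the three direct sums, with [C] equal to [Der K], [Kerf] and [Phi]. As [In1]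
    lies in [C], the diagonal remainder [d - inner c] stays in [C]. *)
Lemma direct_sum_diagonal (C : set (K -> K)) :
    is_submodule C -> In1 M `<=` C -> C `<=` Der K ->
  is_direct_sum C (In1 M) (C `&` [set d | ddelta d = 0]).
Proof.
move=> Csub IC CD; have Isub := image_inner_submodule M_submodule.
split=> //; first exact/submoduleI/ddelta0_submodule.
  apply/seteqP; split=> [d Cd|_ [_ [c Mc <-] [d [Cd _] <-]]]; last first.
    by apply: submoduleD => //; apply: IC; exists c.
  have [c Mc dc] := ddelta_inner (CD _ Cd).
  exists (inner c); first by exists c.
  exists (d - inner c); last by rewrite addrC subrK.
  split; first by apply: submoduleB => //; apply: IC; exists c.
  by rewrite /= addrC -scaleN1r ddelta_linear dc scaleN1r addNr.
apply/seteqP; split=> [_ [[c Mc <-] [_ c0]]|_ ->]; last first.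
  have [I0 _] := (is_submoduleP _).1 Isub.
  have [D0 _] := (is_submoduleP _).1 ddelta0_submodule.
  by split=> //; split=> //; apply: IC.
rewrite (inner_M_diagonal Mc c0); apply/funext => x.
by rewrite /inner mulr0 mul0r subrr.
Qed.

Lemma Kerf_submodule : is_submodule (Kerf L M).
Proof.
have /is_submoduleP[D0 DD] := @Der_submodule T K.
apply/is_submoduleP; split=> [|t d d' [dD d0] [dD' d0']]; split=> //.
- by apply/funext => a; apply: (Lpart_val 0).
- exact: DD.
- by rewrite dalpha_linear d0 d0' scaler0 addr0.
Qed.

Lemma Phi_submodule : is_submodule (Phi L M).
Proof.
have /is_submoduleP[D0 DD] := @Der_submodule T K.
apply/is_submoduleP; split=> [|t d d' [dD [b _ db]] [dD' [b' _ db']]].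
  split=> //; exists 0 => //; rewrite -dalpha_inner_val raddf0.
  by congr dalpha; apply/funext => x; rewrite /inner mulr0 mul0r subrr.
split; first exact: DD.
by exists (t *: b + b') => //; rewrite dalpha_linear -db -db' inner_linear.
Qed.

(** If [alpha] is the inner derivation of [L] by [b], then the inner derivation of [K] by [b] is
    diagonal with the same [alpha]; subtracting it from a diagonal [d] leaves an element of
    [Psi]. *)
Lemma Phi_diagonal :
  Phi L M `&` [set d | ddelta d = 0] = add_set (In0 L) (Psi L M).
Proof.
have Dsub := @Der_submodule T K.
apply/seteqP; split=> [d [[dD [b _ db]] d0]|_ [_ [b bL <-] [d [dD d0 d0'] <-]]].
  exists (inner (val b)); first by exists (val b) => //; apply: subalgP.
  exists (d - inner (val b)); last by rewrite addrC subrK.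
  split; first by apply: submoduleB Dsub dD _; apply: inner_der.
  - by rewrite addrC -scaleN1r dalpha_linear dalpha_inner_val db scaleN1r addNr.
  - by rewrite addrC -scaleN1r ddelta_linear ddelta_inner_val d0 scaler0 addr0.
split; first split; first exact: submoduleD Dsub (inner_der b) dD.
- exists (Subalg bL) => //.
  rewrite -[inner b]scale1r dalpha_linear d0 addr0 scale1r.
  by rewrite -dalpha_inner_val.
- by rewrite /= -[inner b]scale1r ddelta_linear d0' (ddelta_inner_val (Subalg bL)) scaler0 addr0.
Qed.

(** Split the defining element into its two components and use additivity of [inner]. *)
Lemma InDer_add : InDer K = add_set (In1 M) (In0 L).
Proof.
have innerD c c' : inner (c + c') = inner c + inner c' :> (K -> K).
  by rewrite -[c]scale1r inner_linear !scale1r.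
apply/seteqP; split=> [_ [c _ <-]|_ [_ [c _ <-] [_ [c' _ <-] <-]]]; last first.
  by exists (c + c').
exists (inner (Mpart L M c)); first by exists (Mpart L M c) => //; apply: LpartP.
exists (inner (val (Lpart L M c))); last by rewrite -innerD subrK.
by exists (val (Lpart L M c)) => //; apply: subalgP.
Qed.

Lemma derivation_decomposition :
  [/\ is_direct_sum (Der K) (In1 M) (Lambda L M),
      is_direct_sum (Kerf L M) (In1 M) (Psi L M),
      Phi L M = add_set (InDer K) (Psi L M)
    & is_direct_sum (Phi L M) (In1 M) (add_set (In0 L) (Psi L M))].
Proof.
have PsiE : Psi L M = Kerf L M `&` [set d | ddelta d = 0].
  by apply/seteqP; split=> d [] // [].
have PhiP : is_direct_sum (Phi L M) (In1 M) (add_set (In0 L) (Psi L M)).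
  rewrite -Phi_diagonal; apply: direct_sum_diagonal.
  - exact: Phi_submodule.
  - move=> _ [c Mc <-]; split; first exact: inner_der.
    (* For [c] in [M] the component [alpha] is zero, hence inner by 0. *)
    exists 0 => //; rewrite dalpha_inner_M//; apply/funext => a.
    by rewrite /inner mulr0 mul0r subrr.
  - by move=> d [].
split=> //.
- apply: direct_sum_diagonal => //; first exact: Der_submodule.
  by move=> _ [c _ <-]; apply: inner_der.
- rewrite PsiE; apply: direct_sum_diagonal; first exact: Kerf_submodule.
    move=> _ [c Mc <-]; split; [exact: inner_der | exact: dalpha_inner_M].
  by move=> d [].
(* Only associativity remains: [In1 + (In0 + Psi) = (In1 + In0) + Psi]. *)
- case: PhiP => _ _ -> _; rewrite InDer_add; apply/seteqP; split.
    move=> _ [d Id [_ [d' Id' [p Pp <-]] <-]].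
    by exists (d + d'); [exists d => //; exists d' | exists p; rewrite ?addrA].
  move=> _ [_ [d Id [d' Id' <-]] [p Pp <-]].
  by exists d => //; exists (d' + p); [exists d' => //; exists p | rewrite addrA].
Qed.

End BlockDecomposition.

(** * Block idempotents of incidence algebras, one per class of [sim] *)

Section IncidenceBlocks.
Variables (T : comNzRingType) (disp : Order.disp_t).
Variables (X : locFinPreorderType disp) (R : algType T).
Local Notation K := (incidence X R).
Local Notation sim := (@preorder_sim disp X).
Implicit Types (x y u v : X) (f : K).

Lemma sim_refl x : sim x x. Proof. by rewrite /preorder_sim lexx. Qed.

Lemma sim_sym x y : sim x y = sim y x. Proof. exact: andbC. Qed.

Lemma sim_trans x y u : sim x y -> sim y u -> sim x u.
Proof.
move=> /andP[xy yx] /andP[yu uy].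
by rewrite /preorder_sim (le_trans xy yu) (le_trans uy yx).
Qed.

Definition class_idem_fun x : X -> X -> R :=
  fun u v => if sim x u then (1 : K) u v else 0.

Lemma class_idem_subproof x : class_idem_fun x \in incidence_pred X R.
Proof.
by apply/asboolP => u v uv; rewrite /class_idem_fun inc0 ?if_same.
Qed.

Definition class_idem x : K := Incidence (class_idem_subproof x).

Lemma inc_mulM f g u v : (f * g) u v = \sum_(z <- itvs u v) f u z * g z v.
Proof. exact: inc_mul_itvE. Qed.

Lemma class_idem_mull x f u v :
  (class_idem x * f) u v = if sim x u then f u v else 0.
Proof.
rewrite -[f in RHS]mul1r !inc_mulM /= /class_idem_fun; case: ifP => // _.
by rewrite big1// => z _; rewrite mul0r.
Qed.

Lemma class_idem_mulr x f u v :
  (f * class_idem x) u v = if sim x v then f u v else 0.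
Proof.
(* The identity vanishes off the diagonal, so the condition on the row can be moved to the
   column. *)
have idemE z : class_idem x z v = if sim x v then (1 : K) z v else 0.
  rewrite /= /class_idem_fun /= /inc_one_fun.
  by case: eqP => [->//|_]; rewrite !if_same.
rewrite -[f in RHS]mulr1 !inc_mulM; under eq_bigr do rewrite idemE.
by case: ifP => // _; rewrite big1// => z _; rewrite mulr0.
Qed.

(** Makes gluing independent of the representative of a class. *)
Lemma eq_class_idem x u : sim x u -> class_idem x = class_idem u.
Proof.
move=> xu; apply: incP => y v; rewrite /= /class_idem_fun.
suff -> : sim x y = sim u y by [].
by apply/idP/idP; apply: sim_trans; rewrite // sim_sym.
Qed.

Lemma incidence_block_idempotents :
  block_idempotents (incidence_L X R) (incidence_M X R) (range class_idem).
Proof.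
split.
- exact: incidence_decomp.
- move=> _ [x _ <-]; apply/asboolP => u v uv; rewrite /= /class_idem_fun.
  rewrite /= /inc_one_fun; case: eqP uv => [->|_ _]; last by rewrite if_same.
  by rewrite sim_refl.
- move=> _ [x _ <-]; apply: incP => u v; rewrite class_idem_mull.
  by case: ifP => //= xu; rewrite /class_idem_fun xu.
- move=> _ f [x _ <-] /asboolP Lf; apply: incP => u v.
  rewrite class_idem_mull class_idem_mulr.
  have [uv|/Lf->] := boolP (sim u v); last by rewrite !if_same.
  suff -> : sim x u = sim x v by [].
  (* At entries with [u] and [v] equivalent, selecting rows and selecting columns by the class of
     [x] agree. *)
  by apply/idP/idP => /sim_trans; apply; rewrite // sim_sym.
- move=> f; split=> [Mf _ [x _ <-]|Mf u v uv].
    apply: incP => u v; rewrite class_idem_mulr class_idem_mull.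
    case: ifP => // xv; case: ifP => // xu; apply: Mf.
    by apply: sim_trans xv; rewrite sim_sym.
  have /(_ (class_idem u)) := Mf; move=> /(_ (ex_intro2 _ _ u I erefl)).
  move=> /(congr1 (fun h : K => h u v)).
  by rewrite class_idem_mulr class_idem_mull uv sim_refl.
- move=> f f0; apply: incP => u v.
  have /(congr1 (fun h : K => h u v)) := f0 _ (ex_intro2 _ _ u I erefl).
  by rewrite class_idem_mull sim_refl.
- move=> g Mg.
  (* Row [u] is copied from the value of [g] at the idempotent of the class of [u], the one that
     keeps this row. *)
  pose c u v := g (class_idem u) u v.
  have cP : c \in incidence_pred X R by apply/asboolP => u v uv; apply: inc0.
  exists (Incidence cP) => [u v uv|_ [x _ <-]].
    by apply: Mg => //; exists u.
  apply: incP => u v; rewrite !class_idem_mull /= /c.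
  by case: ifP => // /eq_class_idem ->.
Qed.

End IncidenceBlocks.

(** * Block idempotents of formal matrix algebras, one per index *)

Section FormalMatrixBlocks.
Variables (T : comNzRingType) (n : nat) (D : formal_matrix_data T n).
Local Notation K := (formal_matrix D).
Implicit Types (i j k : 'I_n.+1) (a : K).

Definition diag_idem i : K := fun j k => if i == j then (1 : K) j k else 0.

Lemma fm_mulM a b i k : (a * b) i k = \sum_j fm_mul (a i j) (b j k).
Proof. by []. Qed.

Lemma diag_idem_mull i a j k :
  (diag_idem i * a) j k = if i == j then a j k else 0.
Proof.
rewrite -[a in RHS]mul1r !fm_mulM /diag_idem; case: ifP => // _.
by rewrite big1// => l _; rewrite fm_mul0l.
Qed.

Lemma diag_idem_mulr i a j k :
  (a * diag_idem i) j k = if i == k then a j k else 0.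
Proof.
(* As above, the identity being diagonal turns the row condition into a column condition. *)
have idemE l : diag_idem i l k = if i == k then (1 : K) l k else 0.
  rewrite /diag_idem; have [->//|lk] := eqVneq l k.
  by rewrite [(1 : K) l k]fm_one_off// !if_same.
rewrite -[a in RHS]mulr1 !fm_mulM; under eq_bigr do rewrite idemE.
by case: ifP => // _; rewrite big1// => l _; rewrite fm_mul0r.
Qed.

Lemma formal_matrix_block_idempotents :
  block_idempotents (formal_matrix_L D) (formal_matrix_M D) (range diag_idem).
Proof.
split.
- exact: formal_matrix_decomp.
- move=> _ [i _ <-]; apply/asboolP => j k jk; rewrite /diag_idem.
  by rewrite [(1 : K) j k]fm_one_off// if_same.
- move=> _ [i _ <-]; apply: fmP => j k; rewrite diag_idem_mull.
  by case: ifP => // ij; rewrite /diag_idem ij.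
- move=> _ a [i _ <-] /asboolP La; apply: fmP => j k.
  rewrite diag_idem_mull diag_idem_mulr.
  by have [->//|/La->] := eqVneq j k; rewrite !if_same.
- move=> a; split=> [Ma _ [i _ <-]|Ma i].
    apply: fmP => j k; rewrite diag_idem_mulr diag_idem_mull.
    by case: eqP => // <-; case: eqP => // <-; apply: Ma.
  have /(congr1 (fun b : K => b i i)) := Ma _ (ex_intro2 _ _ i I erefl).
  by rewrite diag_idem_mulr diag_idem_mull eqxx.
- move=> a a0; apply: fmP => i j.
  have /(congr1 (fun b : K => b i j)) := a0 _ (ex_intro2 _ _ i I erefl).
  by rewrite diag_idem_mull eqxx.
- move=> g Mg.
  (* Row [i] comes from [g] at the idempotent of index [i]. *)
  exists (fun i j => g (diag_idem i) i j) => [i|_ [i _ <-]].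
    by apply: Mg; exists i.
  by apply: fmP => j k; rewrite !diag_idem_mull; case: eqP => // ->.
Qed.

End FormalMatrixBlocks.

Theorem theorem16p1 (T : comNzRingType) (K : algType T) (L : subalgClosed K)
    (M : set K) (hK : incidence_or_formal_matrix L M) :
  [/\ is_direct_sum (Der K) (In1 M) (Lambda L M),
      is_direct_sum (Kerf L M) (In1 M) (Psi L M),
      Phi L M = add_set (InDer K) (Psi L M)
    & is_direct_sum (Phi L M) (In1 M) (add_set (In0 L) (Psi L M))].
Proof.
case: K L M / hK => [disp X R|n D _].
  exact: derivation_decomposition (incidence_block_idempotents X R).
exact: derivation_decomposition (formal_matrix_block_idempotents D).
Qed.
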